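(* Every finite connected reflective graph $G=(V,E)$ satisfies $$\mathbb{E}_g \operatorname{Ric}\cdot \mathbb{E} d= \mathbb{E}\operatorname{Deg}.$$
   Context: A finite graph $G=(V,E)$ consists of a finite (nonempty) vertex set $V$ and a symmetric relation $E\subset V^2$ with empty diagonal; $x\sim y$ means $(x,y)\in E$. The graph distance is $d(x,y)=\inf\{n: x=x_0\sim\dots\sim x_n=y\}$, and $G$ is connected if $d<\infty$. The Laplacian is $\Delta f(x)=\sum_{y\sim x}(f(y)-f(x))$ for $f:V\to\mathbb{R}$, and $\operatorname{Deg}(x)=\Delta d(x,\cdot)(x)$ is the number of neighbours of $x$. Averages: $\mathbb{E}\operatorname{Deg}=\frac1{|V|}\sum_{x\in V}\operatorname{Deg}(x)$ and $\mathbb{E}d=\frac1{|V|^2}\sum_{x,y\in V}d(x,y)$ (including $x=y$). Edge betweenness centrality: $g(e)=\frac1{|V|^2}\sum_{x,y\in V}\frac1{|P_{xy}|}\sum_{p\in P_{xy}}1_{e\in p}$, where $P_{xy}$ is the set of shortest paths from $x$ to $y$; a path $x_0\sim\dots\sim x_n$ from $x$ to $y$ contains the edges $(x_{k-1},x_k)$, $1\le k\le n$. Ollivier curvature: for $x\ne y$, $$\operatorname{Ric}(x,y)=\inf_{\substack{\|\nabla f\|_\infty=1\\ f(y)-f(x)=d(x,y)}}\frac{\Delta f(x)-\Delta f(y)}{d(x,y)},\qquad \|\nabla f\|_\infty=\sup_{u\sim v}|f(u)-f(v)|,$$ the infimum being over $f:V\to\mathbb{R}$; for an edge $e=(x,y)$,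 $\operatorname{Ric}(e)=\operatorname{Ric}(x,y)$. The weighted average curvature is $$\mathbb{E}_g\operatorname{Ric}=\frac{\sum_{e\in E}g(e)\operatorname{Ric}(e)}{\sum_{e\in E}g(e)},$$ where in the degenerate case $|V|=1$ the quotient $0/0$ is read as $0$. Reflective graphs: for $x\sim y$ let $V_x^y=\{z\in V: d(x,z)<d(y,z)\}$ (so $V_y^x=\{z\in V: d(y,z)<d(x,z)\}$) and $V^{xy}=\{z\in V: d(x,z)=d(y,z)\}$. For $A,B\subset V$ let $E(A,B)=\{(a,b)\in E: a\in A,\ b\in B\}$. A map $\phi:V\to V$ is called a reflection from $x$ to $y$ if: (a) $\phi(x)=y$; (b) $\phi(z)=z$ for all $z\in V^{xy}$; (c) $\phi^2=\mathrm{id}$; (d) $E(V_x^y,V_y^x)=\{(z,\phi(z)): z\in V_x^y\}$; (e) $\phi$ is a graph automorphism. $G$ is called reflective if for all $x\sim y$ there exists a reflection from $x$ to $y$. *)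

(* Defs.v *)
From HB Require Import structures.
From mathcomp Require Import all_boot all_order all_algebra.
From mathcomp Require Import boolp classical_sets reals.

Set Implicit Arguments.
Unset Strict Implicit.
Unset Printing Implicit Defensive.

Import Order.TTheory GRing.Theory Num.Theory.

Local Open Scope ring_scope.

Section Graph.
Variables (V : finType) (E : rel V).

Definition is_graph : Prop :=
  [/\ (0 < #|V|)%N, symmetric E & irreflexive E].

Definition graph_connected : Prop := forall x y : V, connect E x y.

(* A walk x = x_0 ~ x_1 ~ ... ~ x_n = y is encoded by [x_1; ...; x_n],
   the starting point x being kept separately (as in [path E x]). *)
Definition walks (x y : V) (n : nat) : {set n.-tuple V} :=
  [set p : n.-tuple V | path E x p && (last x p == y)]%SET.

(* The value when there is no walk is a junk value: the distance is only
   used in connected graphs. *)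
Definition gdist (x y : V) : nat :=
  if pselect (exists n, walks x y n != finset.set0) is left ex_walk
  then ex_minn ex_walk else 0%N.

Definition shortest_paths (x y : V) : {set (gdist x y).-tuple V} :=
  walks x y (gdist x y).

(* E is a set of ordered pairs: each adjacency contributes two edges. *)
Definition edges : {set V * V} := [set u : V * V | E u.1 u.2]%SET.

Definition path_edges (x : V) (p : seq V) : seq (V * V) :=
  zip (belast x p) p.

Definition edges_between (A B : {set V}) : {set V * V} :=
  [set u in edges | (u.1 \in A) && (u.2 \in B)]%SET.

(* [closer x y] is V_x^y and [equidistant x y] is V^{xy}. *)
Definition closer (x y : V) : {set V} :=
  [set z : V | (gdist x z < gdist y z)%N]%SET.

Definition equidistant (x y : V) : {set V} :=
  [set z : V | gdist x z == gdist y z]%SET.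

Definition graph_automorphism (phi : V -> V) : Prop :=
  bijective phi /\ (forall u v : V, E (phi u) (phi v) = E u v).

Definition is_reflection (x y : V) (phi : V -> V) : Prop :=
  [/\ phi x = y,
      forall z : V, z \in equidistant x y -> phi z = z,
      forall z : V, phi (phi z) = z,
      edges_between (closer x y) (closer y x)
        = [set (z, phi z) | z in closer x y]%SET
    & graph_automorphism phi].

Definition reflective : Prop :=
  forall x y : V, E x y -> exists phi : V -> V, is_reflection x y phi.

Section RealValued.
Variable R : realType.

Definition laplacian (f : V -> R) (x : V) : R :=
  \sum_(y | E x y) (f y - f x).

Definition Deg (x : V) : R := laplacian (fun y => (gdist x y)%:R) x.

Definition mean_deg : R := #|V|%:R^-1 * \sum_(x : V) Deg x.

Definition mean_dist : R :=
  (#|V|%:R ^+ 2)^-1 * \sum_(x : V) \sum_(y : V) (gdist x y)%:R.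

Definition betweenness (u : V * V) : R :=
  (#|V|%:R ^+ 2)^-1 * \sum_(x : V) \sum_(y : V)
    #|shortest_paths x y|%:R^-1 *
      \sum_(p in shortest_paths x y) (u \in path_edges x p)%:R.

Definition grad_norm (f : V -> R) : R :=
  sup [set `|f u.1 - f u.2| | u in [set u : V * V | E u.1 u.2]]%classic.

Definition Ric (x y : V) : R :=
  inf [set (laplacian f x - laplacian f y) / (gdist x y)%:R
      | f in [set f : V -> R
             | grad_norm f = 1 /\ f y - f x = (gdist x y)%:R]]%classic.

(* For |V| = 1 this is 0 / 0, which equals 0 since 0^-1 = 0 in a field. *)
Definition mean_Ric : R :=
  (\sum_(u in edges) betweenness u * Ric u.1 u.2) /
  (\sum_(u in edges) betweenness u).

End RealValued.
End Graph.

(* Main.v *)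
Require Import Defs.
From HB Require Import structures.
From mathcomp Require Import all_boot all_order all_algebra.
From mathcomp Require Import boolp classical_sets reals.
From mathcomp Require Import zify ring lra.

Set Implicit Arguments.
Unset Strict Implicit.
Unset Printing Implicit Defensive.

Import Order.TTheory GRing.Theory Num.Theory.

Local Open Scope ring_scope.

(** Write [d] for the graph distance and fix a base point [x].  In any graph,
    [d x] is admissible in the infimum defining [Ric u v] whenever [(u, v)] is
    an edge pointing away from [x], that is [d x v = d x u + 1]; hence
    [Ric u v] is at most the drop of the Laplacian of [d x] along [(u, v)].
    In a reflective graph [d x] is even a minimiser
    ([Ric_laplacian_gdist]), simultaneously for all edges pointing away from
    [x].  The curvature is thus a discrete gradient along every geodesic
    issued from [x].

    The theorem follows by telescoping.  Along a geodesic from [x] to [y] the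
    curvatures add up to [Deg x - laplacian (d x) y], whichever geodesic is
    chosen, so averaging over geodesics does nothing; summing over [y] kills
    the last term because Laplacians have total sum 0, and summing over [x]
    gives the mean degree ([sum_betweenness] with a potential whose gradient
    is the curvature).  The same computation with the potential [d x], whose
    gradient is 1 on those edges, shows that the total betweenness is the mean
    distance, which is therefore the denominator of the mean curvature.

    Minimality of [d x] is where reflections enter.  The reflection [phi] from
    [u] to [v] matches the neighbours [z] of [u] with the neighbours [phi z]
    of [v], which writes the curvature quotient of a function [f] as a sum over
    [z] of terms [f z - f (phi z) + 1] ([laplacian_reflection]).  The term at
    [z = v] is 2, an equidistant [z] is fixed and contributes 1, and a [z]
    closer to [u] is adjacent to [phi z] and contributes at least 0.  For
    [f = d x] the latter terms vanish ([reflection_gdist_step]). *)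

(** * Graph distance *)

Section Distance.
Variables (V : finType) (E : rel V).
Hypotheses (Esym : symmetric E) (Eirr : irreflexive E).
Hypothesis Econ : graph_connected E.

Notation d := (gdist E).

Lemma walks_neq0P x y n :
  reflect (exists p, [/\ path E x p, last x p = y & size p = n])
          (walks E x y n != finset.set0).
Proof.
apply: (iffP (set0Pn _)) => [[p]|[p [pP pl /eqP ps]]].
  by rewrite inE => /andP[pP /eqP pl]; exists p; rewrite size_tuple.
by exists (Tuple ps); rewrite inE /= pP pl eqxx.
Qed.

Lemma gdist_le_size x p : path E x p -> (d x (last x p) <= size p)%N.
Proof.
move=> pP; rewrite /gdist; case: pselect => // ex_walk.
by case: ex_minnP => m _; apply; apply/walks_neq0P; exists p.
Qed.

Lemma shortest_paths_neq0 x y : shortest_paths E x y != finset.set0.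
Proof.
have /connectP[p pP pl] := Econ x y.
rewrite /shortest_paths /gdist; case: pselect => [ex_walk|[]].
  by case: ex_minnP.
by exists (size p); apply/walks_neq0P; exists p.
Qed.

Lemma geodesicP x y :
  exists p, [/\ path E x p, last x p = y & size p = d x y].
Proof. exact/walks_neq0P/shortest_paths_neq0. Qed.

Lemma gdistxx x : d x x = 0%N.
Proof. by apply/eqP; rewrite -leqn0; apply: (@gdist_le_size x [::]). Qed.

Lemma gdist_eq0 x y : d x y = 0%N -> x = y.
Proof. by case: (geodesicP x y) => -[|a p] [//= _ <- <-]. Qed.

Lemma gdist_edge_left x y z : E x y -> (d x z <= (d y z).+1)%N.
Proof.
move=> xy; have [p [pP <- <-]] := geodesicP y z.
by apply: (@gdist_le_size x (y :: p)); rewrite /= xy.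
Qed.

Lemma gdist_edge_right x y z : E y z -> (d x z <= (d x y).+1)%N.
Proof.
move=> yz; have [p [pP pl <-]] := geodesicP x y.
have := @gdist_le_size x (rcons p z).
by rewrite rcons_path pP pl yz last_rcons size_rcons; apply.
Qed.

Lemma gdist_edge x y : E x y -> d x y = 1%N.
Proof.
move=> xy; have := gdist_edge_right x xy; rewrite gdistxx.
case dxy : (d x y) => [|[|]] //.
by rewrite (gdist_eq0 dxy) Eirr in xy.
Qed.

Lemma gdistC x y : d x y = d y x.
Proof.
suff le a b : (d a b <= d b a)%N by apply/eqP; rewrite eqn_leq !le.
have [p [pP pl <-]] := geodesicP b a.
have := @gdist_le_size a (rev (belast b p)).
rewrite size_rev size_belast -pl rev_path.
have -> : last (last b p) (rev (belast b p)) = b.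
  by case: p {pP pl} => //= c p; rewrite rev_cons last_rcons.
by apply; rewrite (eq_path (e' := E)) // => u v; rewrite Esym.
Qed.

(** Edges may be collapsed as well as preserved: the folding map of a
    reflection identifies the endpoints of the crossing edges. *)
Lemma gdist_contraction (F : V -> V) :
  (forall a b, E a b -> F a = F b \/ E (F a) (F b)) ->
  forall a b, (d (F a) (F b) <= d a b)%N.
Proof.
move=> FE a b; have [p [pP <- <-]] := geodesicP a b.
elim: p a pP => [a _|c p IH a /= /andP[ac /IH le_cp]]; first by rewrite gdistxx.
have [-> |ac'] := FE _ _ ac; first exact: leqW.
exact: leq_trans (gdist_edge_left _ ac') _.
Qed.

(** * Reflections *)

Section Reflection.
Variables (u v : V) (phi : V -> V).
Hypothesis phiP : is_reflection E u v phi.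

Lemma reflection_edge a b : E (phi a) (phi b) = E a b.
Proof. by case: phiP => _ _ _ _ [_]. Qed.

Lemma reflectionK : involutive phi.
Proof. by case: phiP. Qed.

Lemma reflection_src : phi u = v. Proof. by case: phiP. Qed.

Lemma reflection_tgt : phi v = u.
Proof. by rewrite -reflection_src reflectionK. Qed.

Lemma reflection_fix z : d u z = d v z -> phi z = z.
Proof. by case: phiP => _ fixP _ _ _ duv; apply: fixP; rewrite inE duv. Qed.

Lemma reflection_crossing a b :
  E a b -> (d u a < d v a)%N -> (d v b < d u b)%N -> b = phi a.
Proof.
case: phiP => _ _ _ /setP crossP _ ab ua vb.
have := crossP (a, b); rewrite !inE /= ab ua vb /= => /esym/imsetP[c _].
by case=> -> ->.
Qed.

Lemma reflection_closer_edge a : (d u a < d v a)%N -> E a (phi a).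
Proof.
case: phiP => _ _ _ /setP crossP _ ua.
have : (a, phi a) \in [set (z, phi z) | z in closer E u v]%SET.
  by apply/imsetP; exists a; rewrite ?inE.
by rewrite -crossP !inE /= => /andP[].
Qed.

Lemma reflection_gdist a b : d (phi a) (phi b) = d a b.
Proof.
have le c e : (d (phi c) (phi e) <= d c e)%N.
  by apply: gdist_contraction => {c e} c e ce; right; rewrite reflection_edge.
by apply/eqP; rewrite eqn_leq le -{1}(reflectionK a) -{1}(reflectionK b) le.
Qed.

Lemma reflection_closer a : (d v (phi a) < d u (phi a))%N = (d u a < d v a)%N.
Proof.
rewrite -(reflection_gdist u a) -(reflection_gdist v a).
by rewrite reflection_src reflection_tgt.
Qed.

(** Folding the far half-graph onto the near one along [phi] is a contraction
    which fixes [a] and sends [phi b] to [b]. *)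
Lemma reflection_same_side a b : (d u a < d v a)%N -> (d u b < d v b)%N ->
  (d a b <= d a (phi b))%N.
Proof.
move=> ua ub.
pose F z := if (d v z < d u z)%N then phi z else z.
have Fa : F a = a by rewrite /F ltnNge ltnW.
have Fb : F (phi b) = b by rewrite /F reflection_closer ub reflectionK.
rewrite -{1}Fa -{1}Fb; apply: gdist_contraction => {Fa Fb a b ua ub} a b ab.
(* An edge leaving the far side ends on the mirror, which [phi] fixes, or is
   a crossing edge, which the folding collapses. *)
have mixed x y : E x y -> (d v x < d u x)%N -> (d u y <= d v y)%N ->
    phi x = y \/ E (phi x) y.
  move=> xy vx; rewrite leq_eqVlt => /orP[/eqP uy|uy].
    by right; rewrite -(reflection_fix uy) reflection_edge.
  by left; rewrite (reflection_crossing _ uy vx) ?reflectionK // Esym.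
rewrite /F; case: ltnP => va; case: ltnP => vb.
- by right; rewrite reflection_edge.
- exact: mixed.
- rewrite Esym in ab; have [->|] := mixed b a ab vb va; first by left.
  by rewrite Esym; right.
- by right.
Qed.

End Reflection.

Hypothesis Erefl : reflective E.

(** The vertices [u], [v], [phi z], [z] form a 4-cycle without diagonals.
    Folding along [phi] and the edge from [z] to [phi z] leave only the case
    where [x] is equidistant from [z] and [phi z].  Then the reflection from
    [z] to [phi z] fixes [x], but by its crossing-edge condition it also swaps
    the opposite side [u], [v] of the 4-cycle, so [x] would be equidistant from
    [u] and [v]. *)
Lemma reflection_gdist_step u v phi (x z : V) :
  E u v -> is_reflection E u v phi -> d x v = (d x u).+1 ->
  E u z -> (d u z < d v z)%N -> d x (phi z) = (d x z).+1.
Proof.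
move=> uv phiP xuv uz uvz.
have le_z : (d x z <= d x (phi z))%N.
  by apply: (reflection_same_side phiP) => //; rewrite ![d _ x]gdistC xuv.
have z_phi := reflection_closer_edge phiP uvz.
have le_phi := gdist_edge_right x z_phi.
suff : d x z <> d x (phi z) by lia.
move=> xz.
have [psi psiP] := Erefl z_phi.
have psix : psi x = x by apply: (reflection_fix psiP); rewrite !(gdistC _ x).
have vz' : d (phi z) v = d z u.
  by rewrite -(reflection_src phiP) (reflection_gdist phiP).
have uz' : d (phi z) u = d z v.
  by rewrite -(reflection_tgt phiP) (reflection_gdist phiP).
have psiu : v = psi u.
  by apply: (reflection_crossing psiP uv); rewrite ?vz' ?uz' !(gdistC z).
have : d x v = d x u by rewrite psiu -{1}psix (reflection_gdist psiP).
by rewrite xuv => /eqP; rewrite eqn_leq ltnn.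
Qed.

(** * Curvature of an edge *)

Section Curvature.
Variable R : realType.

Notation dist x := (fun z => (d x z)%:R : R).

Lemma laplacian_reflection u v phi (f : V -> R) : is_reflection E u v phi ->
  laplacian E f u - laplacian E f v =
  \sum_(z | E u z) (f z - f (phi z) + (f v - f u)).
Proof.
move=> phiP; have phiK := reflectionK phiP.
rewrite /laplacian [X in _ - X](reindex_inj (inv_inj phiK)) /=.
rewrite [X in _ - X](eq_bigl (E u)) => [|z].
  by rewrite -sumrB; apply: eq_bigr => z _; ring.
by rewrite -(reflection_src phiP) (reflection_edge phiP).
Qed.

(** The comparison holds neighbour by neighbour of [u], through
    [laplacian_reflection]; the only neighbour of [u] closer to [v] is [v]
    itself, since the edge to it is a crossing edge. *)
Lemma laplacian_gdist_min u v x (f : V -> R) :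
  E u v -> d x v = (d x u).+1 ->
  (forall a b, E a b -> f b - f a <= 1) -> f v - f u = 1 ->
  laplacian E (dist x) u - laplacian E (dist x) v
    <= laplacian E f u - laplacian E f v.
Proof.
move=> uv xuv flip fuv; have [phi phiP] := Erefl uv.
rewrite !(laplacian_reflection _ phiP); apply: ler_sum => z uz.
have -> : (d x v)%:R - (d x u)%:R = 1 :> R by rewrite xuv -natr1; ring.
rewrite fuv lerD2r; case: (ltngtP (d u z) (d v z)) => uvz.
- rewrite (reflection_gdist_step uv phiP xuv uz uvz) -natr1.
  by have := flip _ _ (reflection_closer_edge phiP uvz); lra.
- have uu : (d u u < d v u)%N by rewrite gdistxx gdistC gdist_edge.
  rewrite (reflection_crossing phiP uz uu uvz) (reflectionK phiP).
  by rewrite (reflection_src phiP) xuv -natr1; lra.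
- by rewrite (reflection_fix phiP uvz) !subrr.
Qed.

Lemma dist_step x a b : E a b -> (d x b)%:R - (d x a)%:R <= 1 :> R.
Proof. by move=> ab; rewrite lerBlDr nat1r ler_nat gdist_edge_right. Qed.

Lemma grad_norm_le (f : V -> R) a b :
  E a b -> `|f a - f b| <= grad_norm E f.
Proof.
move=> ab; apply: ub_le_sup; last by exists (a, b).
(* The sum of all differences bounds each of them. *)
exists (\sum_(w : V * V) `|f w.1 - f w.2|) => _ [w _ <-].
by rewrite (bigD1 w) //= lerDl sumr_ge0.
Qed.

Lemma grad_norm_dist u v x : E u v -> d x v = (d x u).+1 ->
  grad_norm E (dist x) = 1.
Proof.
move=> uv xuv; apply/le_anti/andP; split.
  apply: ge_sup; first by exists `|(d x u)%:R - (d x v)%:R|, (u, v).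
  move=> _ [[a b] /= ab <-]; rewrite ler_norml.
  have ba : E b a by rewrite Esym.
  by have := dist_step x ab; have := dist_step x ba => /=; lra.
apply: le_trans (grad_norm_le _ uv).
by rewrite xuv -natr1 distrC addrAC subrr add0r normr1.
Qed.

Lemma Ric_laplacian_gdist u v x : E u v -> d x v = (d x u).+1 ->
  Ric E R u v = laplacian E (dist x) u - laplacian E (dist x) v.
Proof.
move=> uv xuv; rewrite /Ric (gdist_edge uv).
set A := [set _ | _ in _]%classic.
set m : R := _ - _.
have A_m : A m.
  exists (dist x); last by rewrite divr1.
  by split; [exact: grad_norm_dist xuv|rewrite xuv -natr1; ring].
have lbA_m : lbound A m.
  move=> _ [f [fnorm fuv] <-]; rewrite divr1.
  apply: laplacian_gdist_min => // a b ab.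
  by rewrite -fnorm (le_trans (ler_norm _)) // distrC grad_norm_le.
apply/le_anti/andP; split; last by apply: lb_le_inf; first exists m.
by apply: ge_inf => //; exists m.
Qed.

(** * Telescoping along geodesics *)

Lemma path_edges_rcons (x : V) p y :
  path_edges x (rcons p y) = rcons (path_edges x p) (last x p, y).
Proof. by rewrite /path_edges belast_rcons lastI zip_rcons // size_belast. Qed.

(** The distances from [x] to the successive vertices of a geodesic are
    1, 2, 3, ...; in particular the vertices are distinct, so no edge is
    repeated. *)
Lemma geodesic_edges x p : path E x p -> size p = d x (last x p) ->
  uniq (path_edges x p) /\
  {in path_edges x p, forall e, E e.1 e.2 /\ d x e.2 = (d x e.1).+1}.
Proof.
move=> pP ps; suff [dp eP] : map (d x) p = iota 1 (size p) /\
    {in path_edges x p, forall e, E e.1 e.2 /\ d x e.2 = (d x e.1).+1}.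
  split=> //; apply: (@map_uniq _ _ (d x \o snd)).
  by rewrite map_comp [map snd _]unzip2_zip ?size_belast // dp iota_uniq.
elim/last_ind: p pP ps => [//|p y IH].
rewrite rcons_path last_rcons size_rcons => /andP[pP py] ps.
have le_p := gdist_le_size pP; have le_y := gdist_edge_right x py.
have {IH} [|dp eP] := IH pP; first by lia.
rewrite map_rcons dp -ps path_edges_rcons; split=> [|e].
  by rewrite -cats1 -[(size p).+1]addn1 iotaD addnC.
rewrite mem_rcons inE => /predU1P[-> /=|/eP//]; split=> //; lia.
Qed.

Lemma sum_path_edges (h : V -> R) x p :
  \sum_(e <- path_edges x p) (h e.2 - h e.1) = h (last x p) - h x.
Proof.
elim: p x => [|y p IH] x; first by rewrite big_nil subrr.
by rewrite big_cons IH /=; ring.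
Qed.

Lemma sum_geodesic (w : V * V -> R) (h : V -> R) x y :
  (forall e, E e.1 e.2 -> d x e.2 = (d x e.1).+1 -> w e = h e.2 - h e.1) ->
  forall p, p \in shortest_paths E x y ->
  \sum_(e in edges E) (e \in path_edges x p)%:R * w e = h y - h x.
Proof.
move=> wh p; rewrite inE => /andP[pP /eqP pl].
have [|puniq pE] := geodesic_edges pP; first by rewrite pl size_tuple.
rewrite -{2}pl -sum_path_edges [RHS]big_uniq //= [LHS]big_mkcond.
rewrite [RHS]big_mkcond; apply: eq_bigr => e _.
have [/pE[Ee de]|_] := boolP (e \in path_edges x p).
  by rewrite inE Ee mul1r wh.
by rewrite mul0r if_same.
Qed.

(** If the weight [w] is the gradient of a potential [h x] on the edges
    pointing away from [x], its sum along a geodesic from [x] depends only on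
    the endpoints, so the average over the geodesics between them is trivial. *)
Lemma sum_betweenness (w : V * V -> R) (h : V -> V -> R) :
  (forall x e, E e.1 e.2 -> d x e.2 = (d x e.1).+1 ->
     w e = h x e.2 - h x e.1) ->
  \sum_(e in edges E) betweenness E R e * w e =
  (#|V|%:R ^+ 2)^-1 * \sum_x \sum_y (h x y - h x x).
Proof.
move=> wh; under eq_bigr do rewrite -mulrA mulr_suml.
rewrite -mulr_sumr exchange_big /=; congr (_ * _); apply: eq_bigr => x _.
under eq_bigr do rewrite mulr_suml.
rewrite exchange_big /=; apply: eq_bigr => y _.
under eq_bigr do rewrite -mulrA mulr_suml.
rewrite -mulr_sumr exchange_big /=.
rewrite (eq_bigr _ (sum_geodesic (wh x))) sumr_const.
rewrite -[(_ - _) *+ _]mulr_natl mulKf //.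
by rewrite pnatr_eq0 cards_eq0 shortest_paths_neq0.
Qed.

(** Each edge contributes opposite amounts at its two endpoints. *)
Lemma sum_laplacian (f : V -> R) : \sum_x laplacian E f x = 0.
Proof.
suff : \sum_x laplacian E f x = - \sum_x laplacian E f x by lra.
rewrite [LHS](exchange_big_dep xpredT) //= -sumrN.
apply: eq_bigr => x _; rewrite -sumrN; apply: eq_big => [y|y _].
  by rewrite Esym.
by rewrite opprB.
Qed.

End Curvature.
End Distance.

Theorem lemma5p2 (R : realType) (V : finType) (E : rel V)
  (HG : is_graph E) (Hconn : graph_connected E) (Hrefl : reflective E) :
  mean_Ric E R * mean_dist E R = mean_deg E R.
Proof.
case: HG => V_gt0 Esym Eirr.
have sum_g : \sum_(e in edges E) betweenness E R e = mean_dist E R.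
  under eq_bigr do rewrite -[betweenness _ _ _]mulr1.
  rewrite (sum_betweenness Hconn (h := fun x z => (gdist E x z)%:R))
    => [|x e _ ->].
    by under eq_bigr do under eq_bigr do rewrite gdistxx // subr0.
  by rewrite -natr1; ring.
have V_neq0 : #|V|%:R != 0 :> R by rewrite pnatr_eq0 -lt0n.
have sum_gRic :
    \sum_(e in edges E) betweenness E R e * Ric E R e.1 e.2 = mean_deg E R.
  pose L x z : R := laplacian E (fun y => (gdist E x y)%:R) z.
  rewrite (sum_betweenness Hconn (h := fun x z => - L x z)); last first.
    move=> x [u v] /= uv xuv.
    rewrite (Ric_laplacian_gdist Esym Eirr Hconn Hrefl R uv xuv).
    by rewrite /L; ring.
  under eq_bigr => x _.
    rewrite big_split /= sumrN sum_laplacian // sumr_const -mulr_natl opprK.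
    over.
  under eq_bigr do rewrite oppr0 add0r.
  by rewrite -mulr_sumr expr2 invfM -mulrA mulKf.
rewrite /mean_Ric sum_g sum_gRic.
have [dist0|dist_neq0] := eqVneq (mean_dist E R) 0; last by rewrite divfK.
(* The remaining case is the one-vertex graph, where 0 / 0 = 0 = Deg. *)
have d0 x y : (gdist E x y)%:R = 0 :> R.
  move/eqP: dist0; rewrite /mean_dist mulf_eq0 invr_eq0 expf_eq0 /=.
  rewrite (negbTE V_neq0) pair_big => /eqP/psumr_eq0P eq0.
  exact: (eq0 _ (x, y)).
rewrite dist0 mulr0 /mean_deg big1 ?mulr0 // => x _.
by rewrite /Deg /laplacian big1 // => y _; rewrite !d0 subrr.
Qed.
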